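(* Consider the disturbance-free system $$\dot x=f(x)+g_2(x)u_0+g_2(x)(u-u_0),\qquad x\in\mathbb R^n,\ u\in\mathbb R^{m_2},$$ with nominal control $u_0=u_0(x,t)$. Let $$\omega_2(x,u_0)=L_{f+g_2u_0}h+\alpha(h(x)),\qquad \bar u_{\rm QP2}(x,u_0)=(L_{g_2}h)^T\,\frac{\max\{0,-\omega_2(x,u_0)\}}{|L_{g_2}h|^2},$$ where $\alpha\in\mathcal K_h$ and $h$ is a control barrier function (CBF), i.e. a barrier function candidate such that $L_{g_2}h(x)=0\Rightarrow\omega_2\ge0$. Then, for any $\beta\ge2$, the control law $$u=u_0+\bar u^*_{\rm QP2}(x,u_0)=u_0+\beta\,\bar u_{\rm QP2}(x,u_0)$$ maximizes (over $u-u_0\in\mathcal U$) the cost functional $$J(u-u_0)=\lim_{t\to\infty}\Big[2\beta h(x(t))+\int_0^t\Big(l(x,u_0)-\frac{|L_{g_2}h|^2\,|u-u_0|^2}{\max\{0,-\omega_2\}}\Big)d\tau\Big],$$ where $l(x,u_0)=2\beta\alpha(h(x))+\beta\min\{(\beta-2)\omega_2,-2\omega_2\}\le2\beta\alpha(h(x))$.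
   Context: $f,g_2$ are locally Lipschitz. A barrier function candidate is a differentiable $h:\mathbb R^n\to\mathbb R$ with $\inf h<0<\sup h$; the safe set is $\mathcal C=\{x:h(x)\ge0\}$, assumed to have no isolated points. $L_fh=\frac{\partial h}{\partial x}f$, $L_{g_2}h=\frac{\partial h}{\partial x}g_2$ (row vector); $|\cdot|$ is the Euclidean norm. $\mathcal K_h$: continuous strictly increasing functions $(\inf h,\sup h)\to\mathbb R$ vanishing at $0$; $\alpha(h(x))$ is understood to be defined for all $x$. Conventions: $\bar u_{\rm QP2}=0$ whenever $\omega_2\ge0$ (in particular whenever $L_{g_2}h=0$). Where $\omega_2\ge0$ the weight on $|u-u_0|^2$ is $+\infty$: the penalty equals $0$ if $u=u_0$ and $+\infty$ otherwise. $\mathcal U$ is the set of admissible control deviations $u-u_0$ (locally bounded functions of $x$, with dependence on $t$ through $u_0(x,t)$ allowed); existence of closed-loop solutions on $[0,\infty)$ and of the limit in $J$ (in the extended reals) is taken for granted for these and $\bar u^*_{\rm QP2}$ is taken to be in $\mathcal U$. In $J$, $x(\cdot)$ is the solution from a given initial state. ''Maximizes'' means $J(u-u_0)\le J(\bar u^*_{\rm QP2})$ for all $u-u_0\in\mathcal U$. *)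

(* Defs.v *)
From HB Require Import structures.
From mathcomp Require Import all_boot all_order all_algebra.
From mathcomp Require Import all_classical all_reals all_analysis.
From mathcomp Require Import measurable_realfun.

Set Implicit Arguments.
Unset Strict Implicit.
Unset Printing Implicit Defensive.

Import Order.TTheory GRing.Theory Num.Theory.
Import numFieldNormedType.Exports.

Local Open Scope classical_set_scope.
Local Open Scope ring_scope.

(* Squared Euclidean norm; the library's norm on matrices is the sup norm,
   used below only in notions invariant under equivalence of norms. *)
Definition sqnorm (R : realType) (p q : nat) (a : 'M[R]_(p, q)) : R :=
  \sum_i \sum_j a i j ^+ 2.

Section barrier.
Context {R : realType} {n : nat}.
Implicit Types (h : 'cV[R]_n -> R) (alpha : R -> R).

Definition hinf h : \bar R := ereal_inf [set (h x)%:E | x in setT].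
Definition hsup h : \bar R := ereal_sup [set (h x)%:E | x in setT].

Definition safe_set h : set 'cV[R]_n := [set x | 0 <= h x].

Definition barrier_candidate h : Prop :=
  [/\ forall x, differentiable h x,
      (hinf h < 0 < hsup h)%E
    & isolated (safe_set h) = set0].

(* The open interval (inf h, sup h), to which range h contributes only those
   of its endpoints that are attained, so that alpha is meaningful at every
   value of h. *)
Definition classK_dom h : set R :=
  [set y : R | (hinf h < y%:E < hsup h)%E] `|` range h.

Definition classK h alpha : Prop :=
  [/\ {within classK_dom h, continuous alpha},
      forall y z, classK_dom h y -> classK_dom h z -> y < z ->
        alpha y < alpha z
    & alpha 0 = 0].

End barrier.

Section safety_filter.
Context {R : realType} {n m : nat}.
Variables (f : 'cV[R]_n -> 'cV[R]_n) (g2 : 'cV[R]_n -> 'M[R]_(n, m)).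
Variables (h : 'cV[R]_n -> R) (alpha : R -> R).
Implicit Types (x : 'cV[R]_n) (u w : 'cV[R]_m) (t : R).

(* In this section u stands for a value of the nominal control u0, and w for
   a value of the deviation u - u0. *)

Definition Lie (k : 'cV[R]_n -> 'cV[R]_n) x : R := 'd h x (k x).

Definition Lg2 x : 'rV[R]_m := \row_j 'd h x (col j (g2 x)).

Definition omega2 x u : R := Lie (fun y => f y + g2 y *m u) x + alpha (h x).

Definition cbf : Prop :=
  barrier_candidate h /\ forall x u, Lg2 x = 0 -> 0 <= omega2 x u.

(* The numerator vanishes when omega2 >= 0, hence so does ubarQP2, even where
   Lg2 x = 0 (division by zero being total). *)
Definition ubarQP2 x u : 'cV[R]_m :=
  (Num.max 0 (- omega2 x u) / sqnorm (Lg2 x)) *: (Lg2 x)^T.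

Variable beta : R.

Definition ustarQP2 x u : 'cV[R]_m := beta *: ubarQP2 x u.

Definition running_gain x u : R :=
  2 * beta * alpha (h x)
  + beta * Num.min ((beta - 2) * omega2 x u) (- 2 * omega2 x u).

(* Infinite weight on |w|^2 where omega2 >= 0. *)
Definition penalty x u w : \bar R :=
  if omega2 x u < 0
  then (sqnorm (Lg2 x) * sqnorm w / Num.max 0 (- omega2 x u))%:E
  else if w == 0 then 0%E else +oo%E.

Variable u0 : 'cV[R]_n -> R -> 'cV[R]_m.

(* A deviation u - u0 is a function v of the state and of the value of u0, so
   that it depends on t only through u0 x t. *)
Implicit Types (v : 'cV[R]_n -> 'cV[R]_m -> 'cV[R]_m)
  (X : R -> 'cV[R]_n).

Definition closed_loop v x t : 'cV[R]_n :=
  f x + g2 x *m u0 x t + g2 x *m v x (u0 x t).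

(* Caratheodory solutions on [0, +oo[, in integral form: deviations are only
   locally bounded, so the right-hand side may be discontinuous. *)
Definition solution v (x0 : 'cV[R]_n) X : Prop :=
  forall (t : R) (i : 'I_n), 0 <= t ->
    lebesgue_measure.-integrable `[0, t]
      (fun s => (closed_loop v (X s) s i 0)%:E) /\
    X t i 0 =
      x0 i 0 + \int[lebesgue_measure]_(s in `[0, t]) closed_loop v (X s) s i 0.

Definition integrand v X (s : R) : \bar R :=
  let x := X s in let u := u0 x s in
  ((running_gain x u)%:E - penalty x u (v x u))%E.

Definition cost_upto v X t : \bar R :=
  ((2 * beta * h (X t))%:E
   + \int[lebesgue_measure]_(s in `[0%R, t]) integrand v X s)%E.

Definition J v X : \bar R := lim (cost_upto v X t @[t --> +oo%R]).

(* The set U of deviations for a given initial state: besides local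
   boundedness, the closed loop has solutions on [0, +oo[ and J is well
   defined along them (measurable integrand, existing limit in \bar R). *)
Definition admissible (x0 : 'cV[R]_n) v : Prop :=
  [/\ forall t, [locally [bounded v x (u0 x t) | x in setT]],
      exists X, solution v x0 X
    & forall X, solution v x0 X ->
        measurable_fun (`[0, +oo[ : set R) (integrand v X) /\
        cvg (cost_upto v X t @[t --> +oo%R])].

(* No uniqueness of solutions is assumed: the inequality is required for every
   solution of either closed loop. *)
Definition maximizes_J (x0 : 'cV[R]_n) vstar : Prop :=
  forall v, admissible x0 v ->
  forall X Xstar, solution v x0 X -> solution vstar x0 Xstar ->
    (J v X <= J vstar Xstar)%E.

End safety_filter.

(* Main.v *)
(* Along a solution, d/dt h(X) = omega2 - alpha(h) + (Lg2 h) w, and completing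
   the square in w shows that the integrand of J is at most -2 beta d/dt h(X),
   with equality for w = ubar*.  Hence J = 2 beta h(x0) for the proposed law and
   J <= 2 beta h(x0) for any other deviation.

   As h is differentiable but not assumed C^1, h o X need not be absolutely
   continuous, and the integrand need not be integrable.  Only a one-sided
   fundamental theorem of calculus is needed: if d/dt h(X) <= G with G^+
   integrable, then h(X T) - h(X 0) is at most the integral of G (applied to h
   and to -h).  For the upper bound on J, the integral of G^+ being infinite
   makes J equal to -oo; for the lower bound, d/dt h(X) >= -alpha(h(X)), which is
   bounded on compact time intervals.  The one-sided theorem holds by a
   continuous induction: at Lebesgue points of X' and G the increment of h o X
   is controlled by that of the integral of G, and at the remaining null set of
   times by a nondecreasing function of arbitrarily small total variation that
   grows faster there than any multiple of the integral of |X'| + |G|. *)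

Require Import Defs.
From HB Require Import structures.
From mathcomp Require Import all_boot all_order all_algebra.
From mathcomp Require Import all_classical all_reals all_analysis.
From mathcomp Require Import measurable_realfun.
From mathcomp Require Import lra ring.

Import Order.TTheory GRing.Theory Num.Theory.
Import numFieldNormedType.Exports.

Local Open Scope classical_set_scope.
Local Open Scope ring_scope.

(** * Small monotone majorants at a null set of times *)

Lemma near_right_itv_sub (R : realType) (t : R) (W : set R) :
  nbhs t W -> \forall v \near t^'+, `]t, v] `<=` W.
Proof.
move=> /nbhs_ballP[d /= d0 dW]; near=> v => y /=; rewrite in_itv/= => /andP[ty yv].
apply: dW; rewrite /ball/= distrC gtr0_norm ?subr_gt0// ltrBlDl.
by apply: le_lt_trans yv _; near: v; apply: nbhs_right_lt; rewrite ltrDl.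
Unshelve. all: by end_near. Qed.

Section null_set_majorant.
Context {R : realType}.
Local Notation mu := (@lebesgue_measure R).

Lemma null_set_majorant (rho : R -> R) (N : set R) (e : R) :
    (forall x, 0 <= rho x) ->
    mu.-integrable setT (EFin \o rho) ->
    mu.-negligible N -> 0 < e ->
  exists P : R -> R, [/\ {homo P : a b / a <= b}, forall t, 0 <= P t <= e
    & forall t K, N t -> \forall v \near t^'+,
        K * \int[mu]_(x in `]t, v]) rho x <= P v - P t].
Proof.
(* P t is the sum over k of the integrals of rho over ]-oo, t] /\ U k, where the
   open sets U k contain N and rho has integral at most e / 2 ^ k.+1 on U k. *)
move=> rho0 irho negN e0.
have mrho : measurable_fun setT (EFin \o rho) by exact: measurable_int irho.
have mrhoS A : measurable_fun A (EFin \o rho) by exact: measurable_funTS.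
have pos A x : A x -> (0 <= (EFin \o rho) x)%E by rewrite /= lee_fin.
have fin A : measurable A -> (\int[mu]_(x in A) (rho x)%:E \is a fin_num)%E.
  move=> mA; apply: integrable_fin_num => //.
  exact: (integrableS measurableT mA (@subsetT _ _) irho).
(* Outer regularity gives an open set of measure below [d] around a measurable null set containing
   [N]; [d] comes from the absolute continuity of the integral of [rho]. *)
have /choice[U UP] (k : nat) : exists U : set R, [/\ open U, N `<=` U
    & (\int[mu]_(x in U) (rho x)%:E <= (e / (2 ^ k.+1)%:R)%:E)%E].
  have ek0 : 0 < e / (2 ^ k.+1)%:R :> R by rewrite divr_gt0 // ltr0n expn_gt0.
  have [d [d0 dP]] := integral_normr_continuous irho ek0.
  have [A [mA A0 NA]] := negN.
  have [|U [oU AU]] := @lebesgue_regularity_outer R A d mA _ d0.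
    by rewrite [X in (X < _)%E](A0 : _ = 0%E) ltry.
  move=> UAd; exists U; split=> //; first exact: subset_trans AU.
  have mU := open_measurable oU.
  have {}UAd : (mu U < d%:E)%E.
    have -> : mu U = (mu A + mu (U `\` A))%E.
      by rewrite -measureU ?setDIK ?setDUK //; exact: measurableD.
    by rewrite [X in (X + _)%E](A0 : _ = 0%E) add0e.
  have := dP _ mU UAd; rewrite /Rintegral.
  under eq_integral do rewrite ger0_norm //.
  by move=> /ltW; rewrite -lee_fin fineK ?fin.
have oU k := let: And3 o _ _ := UP k in o.
have mU k := open_measurable (oU k).
pose r k (A : set R) : \bar R := (\int[mu]_(x in A `&` U k) (rho x)%:E)%E.
have r0 k A : (0 <= r k A)%E by apply: integral_ge0 => x; apply: pos.
have rle k A : measurable A -> (r k A <= (e / (2 ^ k.+1)%:R)%:E)%E.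
  move=> mA; case: (UP k) => _ _; apply: le_trans.
  apply: ge0_subset_integral => //.
  - exact: (measurableI _ _ mA (mU k)).
  - exact: mU.
  - exact: mrhoS.
  - by move=> x _; exact: rho0.
pose S A : \bar R := (\sum_(k <oo) r k A)%E.
have S0 A : (0 <= S A)%E by apply: nneseries_ge0 => ? _ _; exact: r0.
have Sle A : measurable A -> (S A <= e%:E)%E.
  move=> mA; apply: le_trans (epsilon_trick0 xpredT (ltW e0)).
  by apply: lee_nneseries => [? _ _|k _]; [exact: r0|exact: rle].
have Sfin A : measurable A -> S A \is a fin_num.
  by move=> mA; rewrite ge0_fin_numE // (le_lt_trans (Sle _ mA)) ?ltry.
have SD t v : t <= v ->
    S `]-oo, v]%classic = (S `]-oo, t]%classic + S `]t, v]%classic)%E.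
  move=> tv; rewrite /S -nneseriesD //.
  apply: eq_eseriesr => k _; rewrite /r.
  rewrite (@itv_bndbnd_setU _ _ -oo%O (BRight t)) ?bnd_simp // setIUl.
  rewrite ge0_integral_setU //.
  - exact: (measurableI _ _ _ (mU k)).
  - exact: (measurableI _ _ _ (mU k)).
  - exact: mrhoS.
  - by move=> x _; exact: rho0.
  - apply/disj_set2P; rewrite -subset0 => y [[/= + _] [/= + _]].
    by rewrite !in_itv /= => yt; rewrite ltNge yt.
have PD t v : t <= v ->
    fine (S `]-oo, v]%classic) - fine (S `]-oo, t]%classic) = fine (S `]t, v]%classic).
  by move=> tv; rewrite (SD t v tv) fineD ?Sfin // addrC addKr.
exists (fun t => fine (S `]-oo, t]%classic)); split.
- by move=> a b ab; rewrite -subr_ge0 PD // fine_ge0.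
- by move=> t; rewrite fine_ge0 //= -lee_fin fineK ?Sfin // Sle.
- move=> t K Nt.
  (* For [v] close to [t] the interval ]t, v] lies in the first [n] open sets, so each of the first
     [n] terms of the series is the full integral of [rho] over it. *)
  have [n Kn] : exists n : nat, K <= n%:R.
    exists (Num.bound `|K|); rewrite (le_trans (ler_norm K)) //.
    exact/ltW/archi_boundP.
  have nU : nbhs t [set y | forall k : 'I_n, U k y].
    have tU (k : 'I_n) : nbhs t (U k).
      by have [_ NU _] := UP k; apply: open_nbhs_nbhs; split=> //; exact: NU.
    exact: (@filter_forall R 'I_n (fun k => U k) (nbhs t) _ tU).
  near=> v.
  have tv : t <= v by near: v; exact: nbhs_right_ge.
  have vU : `]t, v] `<=` [set y | forall k : 'I_n, U k y].
    by near: v; exact: near_right_itv_sub.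
  rewrite PD //; apply: (@le_trans _ _ (n%:R * \int[mu]_(x in `]t, v]) rho x)).
    by rewrite ler_wpM2r // Rintegral_ge0.
  rewrite -lee_fin fineK ?Sfin //.
  apply: le_trans (nneseries_lim_ge n _) => [|? _ _]; last exact: r0.
  rewrite big_mkord (eq_bigr (fun=> (\int[mu]_(x in `]t, v]) rho x)%:E)).
    by rewrite sumEFin sumr_const card_ord mulr_natl.
  by move=> k _; rewrite /r setIidl ?fineK ?fin // => y /vU; exact.
Unshelve. all: by end_near. Qed.

End null_set_majorant.

(** * Continuous induction and local growth bounds *)

(** Continuous induction on the supremum [m] of the times up to which [E <= E a]: the second
    hypothesis carries the bound to [m], and the first one past it if [m < b]. The second hypothesis
    is weaker than left continuity: [E] may jump downwards. *)
Lemma le_of_right_decreasing (R : realType) (E : R -> R) (a b : R) : a <= b ->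
    (forall t, a <= t < b -> \forall v \near t^'+, E v <= E t) ->
    (forall t c, a < t <= b -> (forall s, a <= s < t -> E s <= c) -> E t <= c) ->
  E b <= E a.
Proof.
move=> ab Eright Eleft.
pose A := [set t | a <= t <= b /\ forall s, a <= s <= t -> E s <= E a].
have Aa : A a.
  split; first by rewrite lexx.
  by move=> s sa; rewrite (_ : s = a) //; apply/eqP; rewrite eq_le andbC.
have supA : has_sup A by split; [exists a|exists b => t [/andP[]]].
set m := sup A.
have am : a <= m by apply: ub_le_sup => //; case: supA.
have mb : m <= b by apply: ge_sup; [exists a|move=> t [/andP[]]].
have Eltm s : a <= s < m -> E s <= E a.
  move=> /andP[le_as sm].
  have ms0 : 0 < m - s by rewrite subr_gt0.
  have [t At] := sup_adherent ms0 supA.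
  rewrite subKr => st; case: At => _; apply; rewrite le_as /=; exact: ltW.
have Em : E m <= E a.
  have [->//|am'] := eqVneq m a.
  by apply: Eleft => //; rewrite lt_neqAle eq_sym am' am mb.
move: mb; rewrite le_eqVlt => /predU1P[<-//|mb].
have /nbhs_ballP[d /= d0 dP] : \forall v \near m^'+, E v <= E m.
  by apply: Eright; rewrite am.
(* A time of [A] beyond [m]: half the radius stays inside the ball around [m], and the cap at [b]
   inside the interval. *)
pose v := Num.min (m + d / 2) b.
have mv : m < v by rewrite lt_min mb ltrDl divr_gt0.
suff : A v by move=> /ub_le_sup-/(_ (proj2 supA)); rewrite leNgt mv.
split; first by rewrite (ltW (le_lt_trans am mv)) ge_min lexx orbT.
move=> s /andP[le_as]; rewrite le_min => /andP[smd sb].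
have [sm|ms] := ltP s m; first by apply: Eltm; rewrite le_as.
move: ms; rewrite le_eqVlt => /predU1P[<-//|ms].
apply: le_trans Em; apply: dP => //.
rewrite /ball/= distrC gtr0_norm ?subr_gt0// ltrBlDl (le_lt_trans smd)//.
by rewrite ltrD2l ltr_pdivrMr// ltr_pMr// ltr1n.
Qed.

Lemma derive_lt_near_right (R : realType) (F : R -> R) (t e : R) :
    derivable F t 1 -> 'D_1 F t < e ->
  \forall v \near t^'+, F v - F t <= e * (v - t).
Proof.
move=> /cvg_ex[/= l Fl].
have -> : 'D_1 F t = l by exact: cvg_lim.
move=> le.
have : \forall h \near 0^', h^-1 *: (F (h *: 1 + t) - F t) < e.
  exact: (cvgr_lt l).
move=> /nbhs_ballP[d /= d0 dP]; near=> v.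
have tv : t < v by near: v; exact: nbhs_right_gt.
have vt0 : 0 < v - t by rewrite subr_gt0.
have : ball 0 d (v - t).
  rewrite /ball/= sub0r normrN gtr0_norm// ltrBlDl.
  by near: v; apply: nbhs_right_lt; rewrite ltrDl.
move=> /dP /(_ (lt0r_neq0 vt0)).
rewrite /GRing.scale/= mulr1 subrK mulrC ltr_pdivrMr// => /ltW.
exact.
Unshelve. all: by end_near. Qed.

(** The differential contributes [M], the little-o remainder 1. This controls [k \o X] at times
    where [X] may have no derivative. *)
Lemma differentiable_lipschitz_near (R : realType) (V W : normedModType R)
    (k : V -> W) (x : V) : differentiable k x ->
  exists2 K : R, 0 <= K & \forall y \near x, `|k y - k x| <= K * `|y - x|.
Proof.
move=> dk.
have [M M0 dM] : exists2 M, M > 0 & forall y, `|'d k x y| <= M * `|y|.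
  by apply: linear_lipschitz; exact: diff_continuous.
exists (M + 1); first by rewrite addr_ge0// ltW.
have ko := diff_locallyx dk.
have : \forall h \near 0, `|k (h + x) - k x| <= (M + 1) * `|h|.
  near=> h; rewrite ko addrAC (addrAC (k x)) subrr add0r mulrDl.
  rewrite (le_trans (ler_normD _ _))// lerD// ?dM //.
  near: h; apply: littleoP; exact: ltr01.
rewrite (near_shift x); apply: filterS => y /=.
by rewrite sub0r subrK.
Unshelve. all: by end_near. Qed.

(** * The one-sided fundamental theorem of calculus with a real-valued bound *)

Section increment.
Context {R : realType} {n : nat}.
Local Notation mu := (@lebesgue_measure R).
Variables (k : 'cV[R]_n -> R) (phi X : R -> 'cV[R]_n) (g : R -> R).
Hypothesis dk : forall x, differentiable k x.
Hypothesis iphi : forall i, mu.-integrable setT (EFin \o (fun s => phi s i 0)).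
Hypothesis ig : mu.-integrable setT (EFin \o g).
Hypothesis XE : forall t i, X t i 0 = X 0 i 0 + \int[mu]_(s in `[0, t]) phi s i 0.

(** One density for all increments: its integral over ]t, v] bounds both the sup norm of [X v - X t]
    and the absolute value of the integral of [g]. *)
Let rho s : R := \sum_i `|phi s i 0| + `|g s|.

Let rho0 s : 0 <= rho s.
Proof. by rewrite addr_ge0// sumr_ge0. Qed.

Let irho : mu.-integrable setT (EFin \o rho).
Proof.
rewrite (_ : _ \o _ = (fun s => \sum_i (`|phi s i 0|)%:E) \+ (fun s => `|g s|%:E))%E.
  apply: integrableD => //; last exact: integrable_norm.
  apply: integrable_sum => // i _.
  exact: integrable_norm (iphi i).
by apply/funext => s /=; rewrite /rho EFinD sumEFin.
Qed.

Let itvS f (A : set R) : measurable A -> mu.-integrable setT (EFin \o f) ->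
  mu.-integrable A (EFin \o f).
Proof. by move=> mA; apply: integrableS. Qed.

Let int_itvB f t v : mu.-integrable setT (EFin \o f) -> 0 <= t -> t <= v ->
  \int[mu]_(s in `[0, v]) f s - \int[mu]_(s in `[0, t]) f s =
  \int[mu]_(s in `]t, v]) f s.
Proof.
move=> fi t0 tv; apply: Rintegral_itvB; rewrite ?bnd_simp//.
exact: itvS.
Qed.

Let int_le_rho f t v : mu.-integrable setT (EFin \o f) ->
    (forall s, `|f s| <= rho s) ->
  `|\int[mu]_(s in `]t, v]) f s| <= \int[mu]_(s in `]t, v]) rho s.
Proof.
move=> fi frho; apply: (le_trans (le_normr_Rintegral _ _)) => //.
  exact: itvS.
apply: le_Rintegral => //; try exact: itvS.
by apply: itvS => //; exact: integrable_norm.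
Qed.

Let norm_X t v : 0 <= t -> t <= v ->
  `|X v - X t| <= \int[mu]_(s in `]t, v]) rho s.
Proof.
move=> t0 tv; rewrite /Num.norm/= mx_normrE.
apply: bigmax_le => [|[i j] _ /=]; first exact: Rintegral_ge0.
rewrite ord1 !mxE (XE v) (XE t) opprD addrACA subrr add0r int_itvB//.
apply: int_le_rho => // s; rewrite /rho (bigD1 i)//= -addrA lerDl.
by rewrite addr_ge0// sumr_ge0.
Qed.

Let norm_g t v : `|\int[mu]_(s in `]t, v]) g s| <= \int[mu]_(s in `]t, v]) rho s.
Proof. by apply: int_le_rho => // s; rewrite lerDr sumr_ge0. Qed.

Local Notation "'I' f" := (fun t => parameterized_integral mu 0 t f)
  (at level 10, f at level 8).

Let good t := (forall i, derivable (I (fun s => phi s i 0)) t 1 /\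
     'D_1 (I (fun s => phi s i 0)) t = phi t i 0) /\
  (derivable (I g) t 1 /\ 'D_1 (I g) t = g t).

(** Lebesgue differentiation, applied to [g] and to the finitely many entries of [phi]. *)
Let ae_good : {ae mu, forall t, 0 < t -> good t}.
Proof.
have F f : mu.-integrable setT (EFin \o f) ->
    {ae mu, forall t, 0 < t -> derivable (I f) t 1 /\ 'D_1 (I f) t = f t}.
  move=> fi.
  have fS y : mu.-integrable [set` Interval (BLeft 0) (BRight y)] (EFin \o f).
    exact: itvS.
  have lf : locally_integrable [set: R] f.
    by apply: open_integrable_locally => //; exact: openT.
  move: (FTC1 fS lf); apply: filterS; first exact: (ae_filter_ringOfSetsType mu).
  move=> t H t0.
  by have := H t0; rewrite derive1E.
have aeF := ae_filter_ringOfSetsType mu.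
have Fphi := @filter_forall _ 'I_n (fun i t => 0 < t ->
  derivable (I (fun s => phi s i 0)) t 1 /\ 'D_1 (I (fun s => phi s i 0)) t = phi t i 0)
  _ aeF (fun i => F _ (iphi i)).
apply: (@filterS2 _ _ aeF _ _ _ _ (F _ ig) Fphi) => t gt phit t0.
split; [by move=> i; exact: phit|exact: gt].
Qed.

Let good_derive t : 0 < t -> good t -> 'd k (X t) (phi t) <= g t ->
  derivable (fun s => k (X s) - I g s) t 1 /\ 'D_1 (fun s => k (X s) - I g s) t <= 0.
Proof.
move=> t0 [Xt [dg Dg]] le.
have XE' i : (fun s => X s i 0) = (fun s => X 0 i 0 + I (fun s => phi s i 0) s).
  by apply/funext => s; exact: XE.
have dX : derivable X t 1.
  apply/derivable_mxP => i j; rewrite ord1 XE'.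
  by apply: derivableD => //; have [] := Xt i.
have DX : 'D_1 X t = phi t.
  rewrite derive_mx //; apply/matrixP => i j; rewrite mxE ord1 XE' deriveD//; last first.
    by have [] := Xt i.
  by rewrite derive_cst add0r; have [_ ->] := Xt i.
have dX' : differentiable X t by exact/derivable1_diffP.
have dkX : differentiable (k \o X) t by exact: differentiable_comp.
have dkX1 : derivable (k \o X) t 1 by exact/derivable1_diffP.
split; first exact: derivableB.
rewrite deriveB // Dg subr_le0 (le_trans _ le)//.
by rewrite -DX [leLHS]deriveE // diff_comp //= [in leRHS]deriveE.
Qed.

Lemma increment_le_integral (T : R) : 0 <= T ->
    {ae mu, forall s, 0 < s < T -> 'd k (X s) (phi s) <= g s} ->
  k (X T) - k (X 0) <= \int[mu]_(s in `[0, T]) g s.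
Proof.
move=> T0 aeD; apply/ler_addgt0Pr => e e0.
(* The error is at most [eta] from [P] and [eta * T] from the slope, [e] in total. *)
pose eta := e / (1 + T).
have T1 : 0 < 1 + T by rewrite ltr_pwDl.
have eta0 : 0 < eta by rewrite divr_gt0.
(* t = 0 is added to N because FTC1 only gives derivability at t > 0. *)
pose N := [set t | t = 0 \/ ~ (0 < t < T -> good t /\ 'd k (X t) (phi t) <= g t)].
have negN : mu.-negligible N.
  apply: negligibleU.
    apply/negligibleP; first exact: measurable_set1.
    exact: lebesgue_measure_set1.
  apply: (@filterS2 _ _ (ae_filter_ringOfSetsType mu) _ _ _ _ ae_good aeD).
  move=> t gt Dt tT; split; last exact: Dt.
  by apply: gt; case/andP : tT.
have [P [Pmono P01 PN]] := null_set_majorant _ _ _ rho0 irho negN eta0.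
suff : k (X T) - I g T - P T - eta * T <= k (X 0) - I g 0 - P 0 - eta * 0.
  have -> : I g 0 = 0 by rewrite /parameterized_integral set_itv1 Rintegral_set1.
  have : eta * (1 + T) = e by rewrite divfK// gt_eqF.
  have := P01 T; have := P01 0; rewrite /parameterized_integral; lra.
pose E t := k (X t) - I g t - P t - eta * t.
apply: (@le_of_right_decreasing _ E 0 T T0) => [t /andP[t0 tT]|t c /andP[t0 tT] Ec].
  (* At a time of [N], with r the integral of [rho] over ]t, v], [k \o X] grows by at most K r and
     [I g] drops by at most r, while [P] grows by at least (K + 1) r. *)
  have [Nt|Nt] := pselect (N t).
    have [K K0 XK] := differentiable_lipschitz_near _ _ _ _ _ (dk (X t)).
    have Xt : X v @[v --> t^'+] --> X t.
      apply/cvgrPdist_lt => d d0; near=> v.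
      have tv : t <= v by near: v; exact: nbhs_right_ge.
      rewrite distrC; apply/(le_lt_trans (norm_X _ _ t0 tv)).
      rewrite Rintegral_itv_obnd_cbnd; last exact: itvS.
      apply: le_lt_trans (ler_norm _) _; move: tv; near: v.
      apply: cvg_within.
      apply: (@parameterized_integral_near_left _ _ (t + 1)); rewrite ?ltrDl//.
      exact: itvS.
    have ineq (kv kt iv it pv pt r x d ev et : R) : d <= K * x -> kv - kt <= d ->
        K * x <= K * r -> - r <= iv - it -> (K + 1) * r <= pv - pt ->
        0 <= ev - et -> kv - iv - pv - ev <= kt - it - pt - et by lra.
    near=> v.
    have tv : t <= v by near: v; exact: nbhs_right_ge.
    apply: ineq (ler_norm _) (ler_wpM2l K0 (norm_X _ _ t0 tv)) _ _ _.
    - by near: v; exact: (Xt _ XK).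
    - have := norm_g t v; rewrite -(int_itvB g _ _ ig t0 tv).
      by rewrite ler_norml => /andP[].
    - by near: v; exact: (PN t (K + 1) Nt).
    - by rewrite -mulrBr mulr_ge0 ?subr_ge0// ltW.
  (* At any other time the derivative of [k \o X] minus [I g] is at most 0, hence below [eta], and
     [P] does not decrease. *)
  have {Nt}[tneq0 gt] : t <> 0 /\ (0 < t < T -> good t /\ 'd k (X t) (phi t) <= g t).
    by move/not_orP : Nt => [? /contrapT].
  have {}t0 : 0 < t by rewrite lt_neqAle t0 andbT eq_sym; exact/eqP.
  have {gt}[|gt Dt] := gt; first by rewrite t0.
  have [dkg Dkg] := good_derive t t0 gt Dt.
  near=> v.
  have tv : t <= v by near: v; exact: nbhs_right_ge.
  have : (k (X v) - I g v) - (k (X t) - I g t) <= eta * (v - t).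
    by near: v; apply: (derive_lt_near_right _ (fun s => k (X s) - I g s)) => //;
       exact: le_lt_trans eta0.
  have := Pmono _ _ tv; rewrite /E; lra.
have Xt : X v @[v --> t^'-] --> X t.
  apply/cvgrPdist_lt => d d0; near=> v.
  have vt : v <= t by near: v; exact: nbhs_left_le.
  have v0 : 0 <= v by near: v; exact: nbhs_left_ge.
  apply/(le_lt_trans (norm_X _ _ v0 vt)).
  rewrite -int_itvB//; apply: le_lt_trans (ler_norm _) _; near: v.
  apply: (@cvgr_dist_lt _ _ _ _ _ (I rho) (I rho t)) => //.
  by apply: parameterized_integral_cvg_at_left => //; exact: itvS.
(* [P] stays out of the limit: it is only known to be monotone, and [P s <= P t] has the right
   sign. *)
have cvgF : k (X s) - I g s - eta * s @[s --> t^'-] --> k (X t) - I g t - eta * t.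
  apply: cvgB; first apply: cvgB.
  - apply: continuous_cvg Xt; exact: differentiable_continuous.
  - by apply: parameterized_integral_cvg_at_left => //; exact: itvS.
  - by apply: cvgMr; apply: cvg_at_left_filter; exact: cvg_id.
suff : k (X t) - I g t - eta * t <= c + P t by rewrite /E; lra.
apply: (cvgr_to_le cvgF); near=> s.
have st : s < t by near: s; exact: nbhs_left_lt.
have s0 : 0 <= s by near: s; exact: nbhs_left_ge.
have := Ec s; rewrite s0 st => /(_ isT); have := Pmono _ _ (ltW st).
rewrite /E; lra.
Unshelve. all: by end_near. Qed.
End increment.

(** * The same theorem on a compact interval, with an extended-real bound *)

Section increment_itv.
Context {R : realType} {n : nat}.
Local Notation mu := (@lebesgue_measure R).
Variables (k : 'cV[R]_n -> R) (phi X : R -> 'cV[R]_n) (T : R).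
Hypothesis dk : forall x, differentiable k x.
Hypothesis T0 : 0 <= T.
Hypothesis iphi : forall i, mu.-integrable `[0, T] (fun s => (phi s i 0)%:E).
Hypothesis XE : forall t i, 0 <= t <= T ->
  X t i 0 = X 0 i 0 + \int[mu]_(s in `[0, t]) phi s i 0.

(** Reduction to the whole line: [phi] is extended by zero outside [0, T], [XT] is the resulting
    primitive, and [G], almost everywhere finite because integrable, is replaced by [fine \o G]. *)
Lemma increment_le_integrable (G : R -> \bar R) :
    mu.-integrable `[0, T] G ->
    (forall s, 0 <= s <= T -> (('d k (X s) (phi s))%:E <= G s)%E) ->
  ((k (X T) - k (X 0))%:E <= \int[mu]_(s in `[0%R, T]) G s)%E.
Proof.
move=> iG DG.
pose phiT : R -> 'cV[R]_n := phi \_ `[0, T]%classic.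
pose XT t : 'cV[R]_n := \col_i (X 0 i 0 + \int[mu]_(s in `[0, t]) phiT s i 0).
have phiTE i : (fun s => phiT s i 0) = (fun s => phi s i 0) \_ `[0, T]%classic.
  by apply/funext => s; rewrite /phiT !patchE; case: ifP => // _; rewrite mxE.
have iphiT i : mu.-integrable setT (EFin \o (fun s => phiT s i 0)).
  by rewrite phiTE -restrict_EFin -integrable_mkcond//; exact: iphi.
pose g : R -> R := (fine \o G) \_ `[0, T]%classic.
have ig : mu.-integrable setT (EFin \o g).
  rewrite /g -restrict_EFin -integrable_mkcond//.
  have mG : measurable_fun `[0, T] G by case/integrableP : iG.
  apply: (le_integrable _ _ _ iG) => //.
    by apply/measurable_EFinP; exact: measurableT_comp.
  by move=> s _ /=; case: (G s) => [r| |] //=; rewrite normr0 leey.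
have Gfin : {ae mu, forall s, `[0, T]%classic s -> G s \is a fin_num}.
  exact: (integrable_ae _ iG).
have XTE t : 0 <= t <= T -> XT t = X t.
  move=> /[dup] t0T /andP[t0 tT]; apply/matrixP => i j; rewrite ord1 mxE (XE t)//.
  congr (_ + _); apply: eq_Rintegral => s; rewrite inE/= in_itv/= => /andP[s0 st].
  by rewrite /phiT patchE mem_set//= in_itv/= s0 (le_trans st).
have aeD : {ae mu, forall s, 0 < s < T -> 'd k (XT s) (phiT s) <= g s}.
  move: Gfin; apply: filterS; first exact: (ae_filter_ringOfSetsType mu).
  move=> s Gs /andP[s0 sT].
  have sT' : `[0, T]%classic s by rewrite /= in_itv/= !ltW.
  rewrite XTE ?(ltW s0) ?(ltW sT)// /phiT /g !patchE mem_set// -lee_fin /= fineK.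
    by apply: DG; rewrite !ltW.
  exact: Gs.
have XTE0 t i : XT t i 0 = XT 0 i 0 + \int[mu]_(s in `[0, t]) phiT s i 0.
  by rewrite (XTE 0) ?lexx// mxE.
have := increment_le_integral k phiT XT g dk iphiT ig XTE0 T T0 aeD.
rewrite !XTE ?lexx ?T0// -lee_fin => /le_trans; apply.
rewrite /Rintegral fineK; last first.
  by apply: integrable_fin_num => //; exact: integrableS ig.
rewrite le_eqVlt; apply/orP; left; apply/eqP.
apply: ae_eq_integral => //.
- by apply: measurable_funTS; exact: measurable_int ig.
- exact: measurable_int iG.
- move: Gfin; apply: filterS; first exact: (ae_filter_ringOfSetsType mu).
  by move=> s Gs sT; rewrite /g patchE mem_set//= fineK//; exact: Gs.
Qed.

(** Truncating [G^-] at [j] gives [m j] and an integrable function [G^+ - m j] above [G], so the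
    integral of [m j] is at most that of [G^+] minus the increment. By monotone convergence [G^-]
    has finite integral, and [G] is integrable after all. *)
Lemma increment_le_ereal_integral (G : R -> \bar R) :
    measurable_fun `[0, T] G ->
    (\int[mu]_(s in `[0%R, T]) G^\+ s < +oo)%E ->
    (forall s, 0 <= s <= T -> (('d k (X s) (phi s))%:E <= G s)%E) ->
  ((k (X T) - k (X 0))%:E <= \int[mu]_(s in `[0%R, T]) G s)%E.
Proof.
move=> mG Gpoo DG.
suff Gnoo : (\int[mu]_(s in `[0%R, T]) G^\- s < +oo)%E.
  apply: increment_le_integrable => //; apply/integrableP; split=> //.
  rewrite [X in (X < _)%E](_ : _ = \int[mu]_(s in `[0%R, T]) (G^\+ s + G^\- s))%E.
    rewrite ge0_integralD //; first exact: lte_add_pinfty.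
      exact: measurable_funepos.
    exact: measurable_funeneg.
  by apply: eq_integral => s _; rewrite -[LHS]/((abse \o G) s) fune_abse.
pose m (j : nat) (s : R) : \bar R := mine (G^\- s)%E (j%:R)%:E.
have mGp : measurable_fun `[0, T] (G^\+)%E by exact: measurable_funepos.
have mGn : measurable_fun `[0, T] (G^\-)%E by exact: measurable_funeneg.
have mm j : measurable_fun `[0, T] (m j) by exact: measurable_mine.
have m0 j s : (0 <= m j s)%E by rewrite le_min funeneg_ge0 lee_fin ler0n.
have ndm s : {homo m^~ s : i j / (i <= j)%N >-> (i <= j)%E}.
  move=> i j ij; rewrite /m le_min ge_min lexx /= ge_min lee_fin ler_nat ij.
  by rewrite orbT.
have iGp : mu.-integrable `[0, T] (G^\+)%E.
  apply/integrableP; split=> //.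
  rewrite [X in (X < _)%E](_ : _ = \int[mu]_(s in `[0%R, T]) (G^\+ s))%E//.
  by apply: eq_integral => s _; rewrite gee0_abs// funepos_ge0.
have im j : mu.-integrable `[0, T] (m j).
  apply/integrableP; split; first exact: mm.
  have jT : (\int[mu]_(s in `[0%R, T]) (j%:R)%:E < +oo)%E.
    rewrite integral_cst// [X in (_ * X)%E](lebesgue_measure_itv `[0, T]) /= lte_fin.
    by case: ifP => _; rewrite ?mule0 -?EFinB -?EFinM ltry.
  apply: le_lt_trans jT; apply: ge0_le_integral => //=.
  - by apply: measurableT_comp => //; exact: mm.
  - by move=> s _; rewrite gee0_abs// ge_min lexx orbT.
have intm j : (\int[mu]_(s in `[0%R, T]) m j s <=
   \int[mu]_(s in `[0%R, T]) G^\+ s - (k (X T) - k (X 0))%:E)%E.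
  rewrite leeBrDl// addeC -leeBrDl; last exact: integrable_fin_num.
  rewrite -integralB//.
  apply: increment_le_integrable; first exact: integrableB.
  move=> s sT; apply: le_trans (DG s sT) _.
  have -> : (G s = G^\+ s - G^\- s)%E by rewrite [in LHS](funeposneg G).
  apply: leeB => //.
  by rewrite ge_min lexx.
have : (\int[mu]_(s in `[0%R, T]) G^\- s <=
   \int[mu]_(s in `[0%R, T]) G^\+ s - (k (X T) - k (X 0))%:E)%E.
  (* A finite value is reached as soon as [j] exceeds it; at +oo the truncation is [j] itself. *)
  have lim_m s : limn (m^~ s) = (G^\- s)%E.
    apply/cvg_lim => //; rewrite /m; have := funeneg_ge0 G s.
    case: (G^\- s)%E => [r _| _|//].
      apply: cvg_near_cst; near=> j; apply/min_idPl; rewrite lee_fin.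
      by near: j; exact: nbhs_infty_ger.
    under eq_fun do rewrite min_r ?leey//.
    exact/cvgeryP/cvgr_idn.
  have := @cvg_monotone_convergence _ _ _ mu `[0, T]%classic _ m _ (fun j s _ => m0 j s)
     (fun s _ => ndm s).
  move=> /(_ (measurable_itv _) mm).
  under eq_integral do rewrite lim_m.
  move=> /cvge_to_le; apply.
  exact: nearW.
move=> /le_lt_trans; apply.
by apply: lte_add_pinfty => //; rewrite -EFinN ltry.
Unshelve. all: by end_near. Qed.
End increment_itv.

(** * Pointwise comparison of the integrand with the derivative of [h] *)

(** The square to be completed, used with [F] the deviation, [G] the row [Lg2], [a] the squared norm
    of that row and [b] equal to [- beta * omega2]. *)
Lemma sum_sqr_lin (R : realType) (m : nat) (a b : R) (F G : 'I_m -> R) :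
  \sum_i (a * F i - b * G i) ^+ 2 =
  a ^+ 2 * (\sum_i F i ^+ 2) - 2 * a * b * (\sum_i G i * F i)
  + b ^+ 2 * (\sum_i G i ^+ 2).
Proof. by rewrite !mulr_sumr -sumrB -big_split /=; apply: eq_bigr => i _; ring. Qed.

Section pointwise.
Context {R : realType} {n m : nat}.
Variables (f : 'cV[R]_n -> 'cV[R]_n) (g2 : 'cV[R]_n -> 'M[R]_(n, m)).
Variables (h : 'cV[R]_n -> R) (alpha : R -> R) (beta : R).
Hypothesis h_cbf : cbf f g2 h alpha.
Hypothesis beta_ge2 : 2 <= beta.
Implicit Types (x : 'cV[R]_n) (u w : 'cV[R]_m).

Lemma cbf_differentiable x : differentiable h x.
Proof. by case: h_cbf => -[]. Qed.

Lemma running_gain_le x u :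
  running_gain f g2 h alpha beta x u <= 2 * beta * alpha (h x).
Proof.
rewrite /running_gain gerDl; have b0 : 0 <= beta by exact: le_trans beta_ge2.
rewrite mulr_ge0_le0// ge_min; have [w0|w0] := leP 0 (omega2 f g2 h alpha x u).
  by apply/orP; right; lra.
by apply/orP; left; rewrite mulr_ge0_le0 ?subr_ge0// ltW.
Qed.

Lemma diff_closed_loop x u w : 'd h x (f x + g2 x *m u + g2 x *m w) =
  omega2 f g2 h alpha x u - alpha (h x) + \sum_j Lg2 g2 h x 0 j * w j 0.
Proof.
rewrite linearD /omega2 /Lie addrK; congr (_ + _).
rewrite [g2 x *m w](_ : _ = \sum_j w j 0 *: col j (g2 x)).
  rewrite linear_sum; apply: eq_bigr => j _.
  by rewrite linearZ mxE mulrC.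
apply/matrixP => i j; rewrite ord1 mxE summxE.
by apply: eq_bigr => l _; rewrite !mxE mulrC.
Qed.

Lemma sqnorm_row (a : 'rV[R]_m) : sqnorm a = \sum_j a 0 j ^+ 2.
Proof. by rewrite /sqnorm big_ord1. Qed.

Lemma sqnorm_col (a : 'cV[R]_m) : sqnorm a = \sum_j a j 0 ^+ 2.
Proof. by apply: eq_bigr => j _; rewrite big_ord1. Qed.

(** Contrapositive of the CBF condition; it allows cancelling the squared norm of [Lg2] below. *)
Lemma sqnorm_Lg2_gt0 x u : omega2 f g2 h alpha x u < 0 ->
  0 < sqnorm (Lg2 g2 h x).
Proof.
move=> w0; rewrite sqnorm_row lt_neqAle sumr_ge0 ?andbT; last first.
  by move=> *; exact: sqr_ge0.
apply/negP => /eqP/esym/eqP; rewrite psumr_eq0 => [/allP L0|*]; last exact: sqr_ge0.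
have : 0 <= omega2 f g2 h alpha x u.
  case: h_cbf => _; apply; apply/matrixP => i j; rewrite ord1 [RHS]mxE.
  by have := L0 j (mem_index_enum _); rewrite sqrf_eq0 => /eqP.
by rewrite leNgt w0.
Qed.

(** Where [omega2 < 0], the right side minus the left is the sum over j of the squares of
    [|Lg2|^2 w_j + beta omega2 (Lg2)_j], divided by [- omega2 |Lg2|^2]. Where [omega2 >= 0], either
    the penalty is infinite or [w = 0], and then both sides agree. *)
Lemma net_gain_le x u w :
  ((running_gain f g2 h alpha beta x u)%:E - penalty f g2 h alpha x u w
   <= (- (2 * beta * 'd h x (f x + g2 x *m u + g2 x *m w)))%:E)%E.
Proof.
rewrite diff_closed_loop /running_gain /penalty.
set om := omega2 _ _ _ _ _ _; set S := \sum_j _.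
have b0 : 0 <= beta by exact: le_trans beta_ge2.
case: ifPn => [om0|].
  have L0 := sqnorm_Lg2_gt0 _ _ om0.
  (* The sign of [beta * om] decides which argument of the minimum in [running_gain] is the
     smaller. *)
  have bom : beta * om <= 0 by rewrite mulr_ge0_le0// ltW.
  rewrite min_l; last lra.
  have p0 : 0 < - om by rewrite oppr_gt0.
  rewrite (max_r (ltW p0)) -EFinB lee_fin.
  have : 0 <= \sum_j (sqnorm (Lg2 g2 h x) * w j 0 - beta * - om * Lg2 g2 h x 0 j) ^+ 2.
    by apply: sumr_ge0 => j _; exact: sqr_ge0.
  rewrite sum_sqr_lin -sqnorm_row -sqnorm_col -/S.
  set L := sqnorm _; set W := sqnorm w => sq.
  have {}sq : 0 <= L * (- om) * (L * W / - om - 2 * beta * S + beta ^+ 2 * - om).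
    apply: le_trans sq _; rewrite le_eqVlt; apply/orP; left; apply/eqP.
    by field; rewrite lt_eqF.
  have {}sq : 0 <= L * W / - om - 2 * beta * S + beta ^+ 2 * - om.
    by move: sq; rewrite pmulr_rge0// mulr_gt0.
  move: sq; set q := L * W / - om; lra.
rewrite -leNgt => om0; case: eqP => [w0|_]; last by rewrite addeNy leNye.
have -> : S = 0 by rewrite /S; apply: big1 => j _; rewrite w0 [X in _ * X]mxE mulr0.
have bom : 0 <= beta * om by rewrite mulr_ge0.
by rewrite sube0 lee_fin min_r; lra.
Qed.

(** Where [omega2 < 0] this deviation satisfies [|Lg2|^2 w = - beta omega2 Lg2^T], so the completed
    squares vanish; elsewhere it is 0 and costs nothing. *)
Lemma net_gain_ustar x u (w := ustarQP2 f g2 h alpha beta x u) :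
  ((running_gain f g2 h alpha beta x u)%:E - penalty f g2 h alpha x u w
   = (- (2 * beta * 'd h x (f x + g2 x *m u + g2 x *m w)))%:E)%E.
Proof.
rewrite diff_closed_loop /running_gain /penalty.
set om := omega2 _ _ _ _ _ _; set S := \sum_j _.
have b0 : 0 <= beta by exact: le_trans beta_ge2.
case: ifPn => [om0|].
  have L0 := sqnorm_Lg2_gt0 _ _ om0.
  have bom : beta * om <= 0 by rewrite mulr_ge0_le0// ltW.
  rewrite min_l; last lra.
  have p0 : 0 < - om by rewrite oppr_gt0.
  rewrite (max_r (ltW p0)).
  set L := sqnorm _ in L0 *.
  have wE j : w j 0 = beta * (- om / L) * Lg2 g2 h x 0 j.
    by rewrite /w /ustarQP2 /ubarQP2 -/om (max_r (ltW p0)) !mxE -/L mulrA.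
  have WE : sqnorm w = (beta * (- om / L)) ^+ 2 * L.
    rewrite sqnorm_col [X in _ = _ * X]sqnorm_row mulr_sumr; apply: eq_bigr => j _.
    by rewrite wE exprMn.
  have -> : S = beta * - om.
    transitivity (beta * (- om / L) * L).
      rewrite [X in _ = _ * X]sqnorm_row mulr_sumr; apply: eq_bigr => j _.
      by rewrite wE; ring.
    by field; rewrite gt_eqF.
  rewrite WE -EFinB; congr EFin; field.
  by rewrite lt_eqF//= gt_eqF.
rewrite -leNgt => om0.
have w0 : w = 0.
  by rewrite /w /ustarQP2 /ubarQP2 max_l ?oppr_le0// mul0r scale0r scaler0.
have -> : S = 0 by rewrite /S; apply: big1 => j _; rewrite w0 [X in _ * X]mxE mulr0.
have bom : 0 <= beta * om by rewrite mulr_ge0.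
rewrite w0 eqxx sube0 min_r; last lra.
by congr EFin; ring.
Qed.

(** The derivative of [h] plus [alpha (h x)] equals [omega2] where that is nonnegative, and
    [(beta - 1) * - omega2] elsewhere. *)
Lemma diff_ustar_ge x u (w := ustarQP2 f g2 h alpha beta x u) :
  - alpha (h x) <= 'd h x (f x + g2 x *m u + g2 x *m w).
Proof.
have b0 : 0 < beta by exact: lt_le_trans beta_ge2.
rewrite diff_closed_loop; set om := omega2 _ _ _ _ _ _.
have [om0|om0] := leP 0 om.
  rewrite big1 => [|j _]; first by lra.
  rewrite /w /ustarQP2 /ubarQP2 max_l ?oppr_le0// mul0r scale0r scaler0.
  by rewrite [X in _ * X]mxE mulr0.
have L0 := sqnorm_Lg2_gt0 _ _ om0.
have p0 : 0 < - om by rewrite oppr_gt0.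
rewrite (_ : \sum_j _ = beta * - om).
  have : 0 <= (beta - 1) * - om
    by rewrite mulr_ge0 ?ltW// subr_gt0 (lt_le_trans _ beta_ge2)// ltr1n.
  lra.
transitivity (beta * (- om / sqnorm (Lg2 g2 h x)) * sqnorm (Lg2 g2 h x)).
  rewrite [X in _ = _ * X]sqnorm_row mulr_sumr; apply: eq_bigr => j _.
  by rewrite /w /ustarQP2 /ubarQP2 -/om (max_r (ltW p0)) !mxE; ring.
by field; rewrite gt_eqF.
Qed.
End pointwise.

(** * Continuity and increments along solutions *)

Lemma cvg_mx (R : realType) (T : Type) (F : set_system T) (p q : nat)
    (M : T -> 'M[R]_(p, q)) (L : 'M[R]_(p, q)) : Filter F ->
  (forall i j, M x i j @[x --> F] --> L i j) -> M x @[x --> F] --> L.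
Proof.
move=> FF ML; apply/cvgrPdist_le => e e0.
have := @filter_forall _ _ (fun ij x => `|L ij.1 ij.2 - M x ij.1 ij.2| <= e) _ FF
  (fun ij : 'I_p * 'I_q => (cvgrPdist_le _ _).1 (ML ij.1 ij.2) e e0).
move=> /(_ FF); apply: filterS => x LM; rewrite /Num.norm/= mx_normrE.
by apply: bigmax_le => [|ij _]; [exact: ltW|rewrite !mxE; exact: LM].
Qed.

(** Continuity of [alpha] is relative to [classK_dom h], which contains every value of [h]. *)
Lemma continuous_comp_classK (R : realType) (n : nat) (h : 'cV[R]_n -> R)
    (alpha : R -> R) :
  continuous h -> classK h alpha -> continuous (alpha \o h).
Proof.
move=> hc [/subspace_continuousP ac _ _] x.
have hx y : classK_dom h (h y) by right; exists y.
apply: (@cvg_comp _ _ _ h alpha _ _ _ _ (ac _ (hx x))).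
move=> A /= hA; apply: (@filterS _ (nbhs x) _ _ _ _ (hc x _ hA)) => y /= Ay.
exact: Ay (hx y).
Qed.

Section trajectory.
Context {R : realType} {n m : nat}.
Local Notation mu := (@lebesgue_measure R).
Variables (f : 'cV[R]_n -> 'cV[R]_n) (g2 : 'cV[R]_n -> 'M[R]_(n, m)).
Variables (u0 : 'cV[R]_n -> R -> 'cV[R]_m) (x0 : 'cV[R]_n).
Variables (v : 'cV[R]_n -> 'cV[R]_m -> 'cV[R]_m) (X : R -> 'cV[R]_n).
Hypothesis solX : solution f g2 u0 v x0 X.

Lemma solution_init : X 0 = x0.
Proof.
apply/matrixP => i j; rewrite ord1; have [_ ->] := solX 0 i (lexx 0).
by rewrite set_itv1 Rintegral_set1 addr0.
Qed.

Lemma solution_continuous T : 0 <= T -> {within `[0, T], continuous X}.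
Proof.
move=> T0; apply/subspace_continuousP => t t0T.
apply: cvg_mx => i j; rewrite ord1.
have [iT _] := solX T i T0.
have /subspace_continuousP/(_ t t0T) := parameterized_integral_continuous T0 iT.
move=> /(cvgD (cvg_cst (x0 i 0))).
have /andP[t0 _] : 0 <= t <= T by move: t0T; rewrite /= in_itv.
have [_ ->] := solX t i t0.
apply: cvg_trans; apply: near_eq_cvg; near=> s.
have s0T : `[0, T]%classic s by near: s; exact: withinT.
have [|_ ->//] := solX s i _.
by move: s0T; rewrite /= in_itv/= => /andP[].
Unshelve. all: by end_near. Qed.

Lemma solution_increment_le (k : 'cV[R]_n -> R) (T : R) (G : R -> \bar R) :
    (forall x, differentiable k x) -> 0 <= T -> measurable_fun `[0, T] G ->
    (\int[mu]_(s in `[0%R, T]) G^\+ s < +oo)%E ->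
    (forall s, 0 <= s <= T ->
      (('d k (X s) (closed_loop f g2 u0 v (X s) s))%:E <= G s)%E) ->
  ((k (X T) - k x0)%:E <= \int[mu]_(s in `[0%R, T]) G s)%E.
Proof.
move=> dk T0 mG Gp DG; rewrite -solution_init.
apply: (increment_le_ereal_integral k
  (fun s => closed_loop f g2 u0 v (X s) s) X T dk T0 _ _ G mG Gp DG).
  by move=> i; have [] := solX T i T0.
move=> t i /andP[t0 _]; rewrite solution_init; have [_ ->//] := solX t i t0.
Qed.

End trajectory.

(** * Bounds on the cost at finite times, and optimality *)

Section cost.
Context {R : realType} {n m : nat}.
Local Notation mu := (@lebesgue_measure R).
Variables (f : 'cV[R]_n -> 'cV[R]_n) (g2 : 'cV[R]_n -> 'M[R]_(n, m)).
Variables (h : 'cV[R]_n -> R) (alpha : R -> R) (beta : R).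
Variables (u0 : 'cV[R]_n -> R -> 'cV[R]_m) (x0 : 'cV[R]_n).
Hypothesis alphaK : classK h alpha.
Hypothesis h_cbf : cbf f g2 h alpha.
Hypothesis beta_ge2 : 2 <= beta.

Local Notation vstar := (ustarQP2 f g2 h alpha beta).
Local Notation net_gain v X := (integrand f g2 h alpha beta u0 v X).

Let dh (c : R) x : differentiable (c *: h) x.
Proof. exact/differentiableZ/(cbf_differentiable _ _ _ _ h_cbf). Qed.

Let dhE (c : R) x y : 'd (c *: h) x y = c * 'd h x y.
Proof. by rewrite diffZ//; exact: cbf_differentiable h_cbf x. Qed.

Let scaleE (c : R) x : (c *: h) x = c * h x.
Proof. by []. Qed.

(** The one-sided theorem for [(2 * beta) *: h] with the bound [- I], whose positive part is
    [I^-]. *)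
Lemma cost_upto_le v X (t : R) : 0 <= t -> solution f g2 u0 v x0 X ->
    measurable_fun `[0, t] (net_gain v X) ->
  (cost_upto f g2 h alpha beta u0 v X t <= (2 * beta * h x0)%:E)%E.
Proof.
move=> t0 solX mI; rewrite /cost_upto; set I := net_gain v X.
have [Inoo|Inoo] := ltP (\int[mu]_(s in `[0%R, t]) I^\- s)%E +oo%E; last first.
  (* The library sets +oo - +oo = -oo, so the integral of I is -oo even when
     that of I^+ is infinite too. *)
  have {}Inoo : (\int[mu]_(s in `[0%R, t]) I^\- s)%E = +oo%E.
    by apply/eqP; rewrite -leye_eq.
  by rewrite [X in (_ + X)%E]integralE Inoo !addeNy leNye.
have mNI : measurable_fun `[0, t] (\- I)%E by exact: measurableT_comp.
have NIp : (\int[mu]_(s in `[0%R, t]) (\- I)^\+ s < +oo)%E by rewrite funeposN.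
have NID s : 0 <= s <= t -> (('d ((2 * beta) *: h) (X s)
    (closed_loop f g2 u0 v (X s) s))%:E <= (\- I) s)%E.
  move=> _; rewrite dhE leeNr -EFinN.
  exact: (net_gain_le _ _ _ _ _ h_cbf beta_ge2 (X s) (u0 (X s) s)).
have := solution_increment_le f g2 u0 x0 v X solX ((2 * beta) *: h) t _
  (dh _) t0 mNI NIp NID.
rewrite integralN; last first.
  by rewrite fin_num_adde_defl// fin_numN ge0_fin_numE// integral_ge0.
(* The value +oo contradicts the inequality just obtained; -oo makes the cost -oo. *)
case: (\int[mu]_(s in `[0%R, t]) I s)%E => [r| |] //=; last by rewrite addeNy leNye.
by rewrite -EFinD !lee_fin !scaleE; lra.
Qed.

(** The one-sided theorem for [- (2 * beta) *: h], whose differential applied to the closed-loop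
    field is exactly [I]. *)
Lemma cost_upto_ge X (t : R) : 0 <= t -> solution f g2 u0 vstar x0 X ->
    measurable_fun `[0, t] (net_gain vstar X) ->
  ((2 * beta * h x0)%:E <= cost_upto f g2 h alpha beta u0 vstar X t)%E.
Proof.
move=> t0 solX mI; rewrite /cost_upto; set I := net_gain vstar X.
have hc : continuous h.
  move=> x; apply: differentiable_continuous; exact: cbf_differentiable h_cbf x.
have [c _ cmax] : exists2 c, c \in `[0, t] & forall s, s \in `[0, t] ->
    (alpha \o h) (X s) <= (alpha \o h) (X c).
  apply: EVT_max => //; apply: within_continuous_comp.
    by move=> x _; exact: continuous_comp_classK.
  exact: solution_continuous solX _ t0.
have b0 : 0 <= 2 * beta by rewrite mulr_ge0// (le_trans _ beta_ge2).
have IE s : I s = ('d (- (2 * beta) *: h) (X s)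
    (closed_loop f g2 u0 vstar (X s) s))%:E.
  rewrite dhE mulNr.
  exact: (net_gain_ustar _ _ _ _ _ h_cbf beta_ge2 (X s) (u0 (X s) s)).
(* [I] is at most [2 * beta * alpha (h (X s))], which the extreme value theorem bounds on [0, t];
   the maximum with 0 serves the positive part. *)
pose C := 2 * beta * Num.max 0 ((alpha \o h) (X c)).
have IpC s : `[0, t]%classic s -> (I^\+ s <= C%:E)%E.
  move=> s0t; rewrite funeposE ge_max IE !lee_fin dhE; apply/andP; split; last first.
    by rewrite mulr_ge0// le_max lexx.
  rewrite mulNr -mulrN; apply: ler_wpM2l => //; rewrite le_max.
  apply/orP; right; apply: le_trans (cmax s s0t); rewrite lerNl.
  exact: (diff_ustar_ge _ _ _ _ _ h_cbf beta_ge2 (X s) (u0 (X s) s)).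
have Ip : (\int[mu]_(s in `[0%R, t]) I^\+ s < +oo)%E.
  have Coo : (\int[mu]_(s in `[0%R, t]) C%:E < +oo)%E.
    rewrite integral_cst// [X in (_ * X)%E](lebesgue_measure_itv `[0, t]) /= lte_fin.
    by case: ifP => _; rewrite ?mule0 -?EFinB -?EFinM ltry.
  apply: le_lt_trans Coo; apply: ge0_le_integral => //=.
  exact: measurable_funepos.
have ID s : 0 <= s <= t -> (('d (- (2 * beta) *: h) (X s)
    (closed_loop f g2 u0 vstar (X s) s))%:E <= I s)%E by rewrite IE.
have := solution_increment_le f g2 u0 x0 vstar X solX _ t I (dh _) t0 mI Ip ID.
case: (\int[mu]_(s in `[0%R, t]) I s)%E => [r| |] //=; last by rewrite addey ?leey.
by rewrite -EFinD !lee_fin !scaleE; lra.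
Qed.

End cost.

Theorem corollary1 (R : realType) (n m : nat)
    (f : 'cV[R]_n -> 'cV[R]_n) (g2 : 'cV[R]_n -> 'M[R]_(n, m))
    (u0 : 'cV[R]_n -> R -> 'cV[R]_m)
    (h : 'cV[R]_n -> R) (alpha : R -> R) (beta : R)
    (f_lip : [locally [lipschitz f x | x in setT]])
    (g2_lip : [locally [lipschitz g2 x | x in setT]])
    (alphaK : classK h alpha)
    (h_cbf : cbf f g2 h alpha)
    (beta_ge2 : 2 <= beta) :
  (forall (x : 'cV[R]_n) (u : 'cV[R]_m),
     running_gain f g2 h alpha beta x u <= 2 * beta * alpha (h x)) /\
  (forall x0 : 'cV[R]_n,
     admissible f g2 h alpha beta u0 x0 (ustarQP2 f g2 h alpha beta) ->
     maximizes_J f g2 h alpha beta u0 x0 (ustarQP2 f g2 h alpha beta)).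
Proof.
split=> [x u|x0 [_ _ star_ok] v [_ _ v_ok] X Xstar solX solXstar].
  exact: running_gain_le.
have [mI cvgJ] := v_ok X solX; have [mI' cvgJ'] := star_ok Xstar solXstar.
(* This value separates the two costs at every time [t >= 0], hence also their limits. *)
apply: (@le_trans _ _ (2 * beta * h x0)%:E).
  apply: lime_le => //; near=> t.
  have t0 : 0 <= t by near: t; exact: nbhs_pinfty_ge.
  apply: cost_upto_le => //.
  apply: measurable_funS mI => //; exact: subset_itvl.
apply: lime_ge => //; near=> t.
have t0 : 0 <= t by near: t; exact: nbhs_pinfty_ge.
apply: cost_upto_ge => //.
apply: measurable_funS mI' => //; exact: subset_itvl.
Unshelve. all: by end_near. Qed.
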